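(* Let $\alpha\in[1,2)$. For any vector $\mathbf{g}\in\mathbb{R}^{N-1}$, the computational complexity and the memory requirement of the matrix-vector multiplication $\mathbf{A}\mathbf{g}$, where $\mathbf{A}$ is the coefficient matrix of the fast collocation scheme on a general nonuniform grid with $N$ subintervals and $\tilde N_e$ exponentials in the SOE approximation, are $\mathcal{O}(N\tilde N_e)$.
   Context: Complexity counts elementary real operations (including evaluation of exponentials, logarithms and powers) in exact arithmetic, memory counts stored real numbers, and the $\mathcal{O}$-constants are absolute. The input consists of $\alpha$, the grid, the SOE parameters and $\mathbf{g}$; the matrix $\mathbf{A}$ is not assembled. Grid: $a=x_0<x_1<\cdots<x_N=b$, $h_j=x_j-x_{j-1}$. $\phi_j$ ($1\le j\le N-1$) is the continuous piecewise linear hat function with $\phi_j(x_k)=\delta_{jk}$, zero outside $[x_{j-1},x_{j+1}]$. For $v=(v_0,\dots,v_N)$ with $v_0=v_N=0$, $\Pi_hv(y)=\sum_{j=1}^{N-1}v_j\phi_j(y)$. The SOE parameters are positive numbers $\tilde\lambda_s,\tilde\theta_s$, $1\le s\le\tilde N_e$ (chosen so that $\sum_s\tilde\theta_se^{-\tilde\lambda_sx}$ approximates $x^{-\alpha}$). The matrix $\mathbf{A}\in\mathbb{R}^{(N-1)\times(N-1)}$ is the matrix of the linear map $\mathbf{g}=(v_1,\dots,v_{N-1})\mapsto(\mathcal{L}_h[v]_i)_{i=1}^{N-1}$ (with $v_0=v_N=0$), where, with $C_\alpha=\frac{\alpha2^{\alpha-1}\Gamma(\frac{1+\alpha}{2})}{\pi^{1/2}\Gamma(1-\frac{\alpha}{2})}$,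 for $\alpha=1$ $$\mathcal{L}_h[v]_i=C_\alpha\Big\{-\frac{1+\ln h_i}{h_i}v_{i-1}+\Big(\frac{1+\ln h_i}{h_i}+\frac{1+\ln h_{i+1}}{h_{i+1}}\Big)v_i-\frac{1+\ln h_{i+1}}{h_{i+1}}v_{i+1}+\frac1\alpha\sum_{s=1}^{\tilde N_e}\tilde\theta_s\big(\tilde{\mathcal{S}}^L_{i,s}[v]+\tilde{\mathcal{S}}^R_{i,s}[v]\big)\Big\},$$ and for $\alpha\in(1,2)$ $$\mathcal{L}_h[v]_i=C_\alpha\Big\{-\frac{1}{\alpha(1-\alpha)}\Big(h_i^{-\alpha}v_{i-1}-(h_i^{-\alpha}+h_{i+1}^{-\alpha})v_i+h_{i+1}^{-\alpha}v_{i+1}\Big)+\frac1\alpha\sum_{s=1}^{\tilde N_e}\tilde\theta_s\big(\tilde{\mathcal{S}}^L_{i,s}[v]+\tilde{\mathcal{S}}^R_{i,s}[v]\big)\Big\},$$ with $\tilde{\mathcal{S}}^L_{i,s}[v]=\int_{-\infty}^{x_{i-1}}e^{-\tilde\lambda_s(x_i-y)}[\Pi_hv(y)]'\,dy$ and $\tilde{\mathcal{S}}^R_{i,s}[v]=-\int_{x_{i+1}}^{+\infty}e^{-\tilde\lambda_s(y-x_i)}[\Pi_hv(y)]'\,dy$. *)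

(* Defs.v *)
From HB Require Import structures.
From mathcomp Require Import all_boot all_order all_algebra.
From mathcomp Require Import all_classical all_reals all_analysis.

Set Implicit Arguments.
Unset Strict Implicit.
Unset Printing Implicit Defensive.

Import Order.TTheory GRing.Theory Num.Theory.
Import numFieldNormedType.Exports.

Local Open Scope classical_set_scope.
Local Open Scope ring_scope.

Section Scheme.
Context {R : realType}.

Definition Gamma (z : R) : R :=
  Rintegral lebesgue_measure `]0, +oo[
    (fun t : R => t `^ (z - 1) * expR (- t)).

Definition Calpha (alpha : R) : R :=
  alpha * 2 `^ (alpha - 1) * Gamma ((1 + alpha) / 2)
  / (pi `^ (1 / 2) * Gamma (1 - alpha / 2)).

(* A grid x_0 < ... < x_N is the restriction to 0..N of a function on nat. *)
Definition step (x : nat -> R) (j : nat) : R := x j - x j.-1.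

Definition hat (x : nat -> R) (j : nat) (y : R) : R :=
  if x j.-1 <= y <= x j then (y - x j.-1) / step x j
  else if x j <= y <= x j.+1 then (x j.+1 - y) / step x j.+1
  else 0.

Definition interpolant (N : nat) (x v : nat -> R) (y : R) : R :=
  \sum_(1 <= j < N) v j * hat x j y.

(* The interpolant is not differentiable at the nodes; the default value that
   derive1 takes there does not affect these Lebesgue integrals. *)
Definition SL (N : nat) (x : nat -> R) (lambda : R) (v : nat -> R) (i : nat)
    : R :=
  Rintegral lebesgue_measure `]-oo, x i.-1]
    (fun y : R => expR (- lambda * (x i - y)) * derive1 (interpolant N x v) y).

Definition SR (N : nat) (x : nat -> R) (lambda : R) (v : nat -> R) (i : nat)
    : R :=
  - Rintegral lebesgue_measure `[x i.+1, +oo[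
    (fun y : R => expR (- lambda * (y - x i)) * derive1 (interpolant N x v) y).

(* The exponentials s = 1, ..., Ne are numbered from 0. *)
Definition nonlocal (N Ne : nat) (x lambda theta v : nat -> R) (i : nat) : R :=
  \sum_(s < Ne) theta s * (SL N x (lambda s) v i + SR N x (lambda s) v i).

Definition Lh (N Ne : nat) (alpha : R) (x lambda theta v : nat -> R) (i : nat)
    : R :=
  let h := step x in
  Calpha alpha *
  (if alpha == 1 then
     - ((1 + ln (h i)) / h i) * v i.-1
     + ((1 + ln (h i)) / h i + (1 + ln (h i.+1)) / h i.+1) * v i
     - (1 + ln (h i.+1)) / h i.+1 * v i.+1
     + 1 / alpha * nonlocal N Ne x lambda theta v i
   else
     - (1 / (alpha * (1 - alpha)))
       * (h i `^ (- alpha) * v i.-1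
          - (h i `^ (- alpha) + h i.+1 `^ (- alpha)) * v i
          + h i.+1 `^ (- alpha) * v i.+1)
     + 1 / alpha * nonlocal N Ne x lambda theta v i).

(* g = (v_1, ..., v_{N-1}) extended by v_0 = v_N = 0; entry j of the column
   vector is v_{j+1}. *)
Definition extend (N : nat) (g : 'cV[R]_N.-1) (k : nat) : R :=
  if k is k'.+1 then oapp (fun j : 'I_N.-1 => g j ord0) 0 (insub k') else 0.

Definition coef_mx (N Ne : nat) (alpha : R) (x lambda theta : nat -> R)
    : 'M[R]_N.-1 :=
  \matrix_(i, j) Lh N Ne alpha x lambda theta (extend (delta_mx j ord0)) i.+1.

End Scheme.

(* A real random access machine.  Memory consists of cells (a, k), the k-th
   entry of array number a, each holding one exact real number.  Control is
   restricted to bounded loops and order tests on reals; indices and loop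
   bounds are expressions in N, Ne and the counters of the enclosing loops.
   One program therefore serves all N and Ne, and the only reals that it
   contains are integers and pi. *)

Definition cell : Type := (nat * nat)%type.

(* IVar k is the counter of the k-th enclosing loop, innermost first;
   ISub is truncated. *)
Inductive index : Type :=
| INum of nat
| IN
| INe
| IVar of nat
| IAdd of index & index
| ISub of index & index
| IMul of index & index.

(* Gamma is a primitive because C_alpha is not part of the input and has no
   expression through the other operations. *)
Inductive const : Type := Int of int | Pi.
Inductive unop : Type := Copy | Exp | Ln | GammaFun.
Inductive binop : Type := Add | Sub | Mul | Div | Pow.

Definition address : Type := (nat * index)%type.

Inductive program : Type :=
| Skip
| Set0 of address & const
| Set1 of address & unop & address
| Set2 of address & binop & address & address
| Seq of program & program
| IfLe of address & address & program & program
| For of index & program.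

Section Semantics.
Context {R : realType}.

Definition const_sem (c : const) : R :=
  match c with Int z => z%:~R | Pi => pi end.

Definition unop_sem (o : unop) : R -> R :=
  match o with
  | Copy => id
  | Exp => @expR R
  | Ln => @ln R
  | GammaFun => Gamma
  end.

Definition binop_sem (o : binop) (a b : R) : R :=
  match o with
  | Add => a + b
  | Sub => a - b
  | Mul => a * b
  | Div => a / b
  | Pow => a `^ b
  end.

Definition store : Type := cell -> R.

Definition update (m : store) (c : cell) (r : R) : store :=
  fun c' => if c' == c then r else m c'.

(* ops counts the executed assignments (copies included) and real tests;
   touched lists the cells that held input or were read or written so far. *)
Record state : Type :=
  State { mem : store; ops : nat; touched : seq cell }.

Fixpoint index_sem (N Ne : nat) (env : seq nat) (e : index) : nat :=
  match e with
  | INum n => n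
  | IN => N
  | INe => Ne
  | IVar k => nth 0%N env k
  | IAdd e1 e2 => (index_sem N Ne env e1 + index_sem N Ne env e2)%N
  | ISub e1 e2 => (index_sem N Ne env e1 - index_sem N Ne env e2)%N
  | IMul e1 e2 => (index_sem N Ne env e1 * index_sem N Ne env e2)%N
  end.

Definition address_sem (N Ne : nat) (env : seq nat) (a : address) : cell :=
  (a.1, index_sem N Ne env a.2).

Definition assign (d : cell) (r : R) (args : seq cell) (st : state) : state :=
  State (update (mem st) d r) (ops st).+1 (d :: args ++ touched st).

Fixpoint exec (N Ne : nat) (p : program) (env : seq nat) (st : state)
    {struct p} : state :=
  let cell_of := address_sem N Ne env in
  match p with
  | Skip => st
  | Set0 d c => assign (cell_of d) (const_sem c) [::] st
  | Set1 d o a =>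
      assign (cell_of d) (unop_sem o (mem st (cell_of a))) [:: cell_of a] st
  | Set2 d o a b =>
      assign (cell_of d)
        (binop_sem o (mem st (cell_of a)) (mem st (cell_of b)))
        [:: cell_of a; cell_of b] st
  | Seq p1 p2 => exec N Ne p2 env (exec N Ne p1 env st)
  | IfLe a b p1 p2 =>
      let st' := State (mem st) (ops st).+1
                   [:: cell_of a, cell_of b & touched st] in
      if mem st (cell_of a) <= mem st (cell_of b)
      then exec N Ne p1 env st' else exec N Ne p2 env st'
  | For e p1 =>
      iteri (index_sem N Ne env e) (fun k => exec N Ne p1 (k :: env)) st
  end.

Definition memory_usage (st : state) : nat := size (undup (touched st)).

(* Arrays 0 to 4 receive alpha, the grid, the SOE parameters and g; every
   other cell, in particular the output array 5, starts at 0. *)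
Definition input (N Ne : nat) (alpha : R) (x lambda theta : nat -> R)
    (g : 'cV[R]_N.-1) : seq (cell * R) :=
  ((0, 0)%N, alpha)
  :: [seq ((1, k)%N, x k) | k <- iota 0 N.+1]
  ++ [seq ((2, s)%N, lambda s) | s <- iota 0 Ne]
  ++ [seq ((3, s)%N, theta s) | s <- iota 0 Ne]
  ++ [seq ((4, val j)%N, g j ord0) | j <- enum 'I_N.-1].

Definition load (s : seq (cell * R)) : state :=
  State (foldr (fun e m => update m e.1 e.2) (fun=> 0) s) 0
    [seq e.1 | e <- s].

Definition output (n : nat) (st : state) : 'cV[R]_n :=
  \col_i mem st (5, val i)%N.

Definition run (N Ne : nat) (p : program) (s : seq (cell * R)) : state :=
  exec N Ne p [::] (load s).

End Semantics.

(* Main.v *)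
Require Import Defs.
From HB Require Import structures.
From mathcomp Require Import all_boot all_order all_algebra.
From mathcomp Require Import all_classical all_reals all_analysis.
From mathcomp Require Import measurable_realfun ring lra zify.

Set Implicit Arguments.
Unset Strict Implicit.
Unset Printing Implicit Defensive.

Import Order.TTheory GRing.Theory Num.Theory.
Local Open Scope ring_scope.

(** Write v for the extension of g by v_0 = v_N = 0.  Since [Lh] is linear in
    v, the i-th entry of the product is [Lh] applied to v at node i, and only
    its nonlocal part is not visibly computable in O(1) operations per node.

    The derivative of the interpolant is constant between consecutive nodes
    and zero outside the grid, and exponentials have explicit primitives.  So
    the integral over one cell of the grid, seen from a point z, is
    [kernel_segment], and the two nonlocal integrals at node i are sums of such
    terms over the cells to the left of x_(i-1), respectively to the right of
    x_(i+1) ([SL_segments], [SR_segments]).  Moving the point from z to z'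
    multiplies every term by the same factor exp(-mu (z' - z)); hence the sum at
    a node follows from the sum at the preceding node by one multiplication and
    the addition of one new cell ([sweep_sumS]).  One pass over the grid from
    the left and one from the right thus yield all the integrals that belong to
    one exponential in O(N) operations.  Reading the grid backwards and changing
    the sign of lambda turns the right-hand integrals into the left-hand ones,
    so a single program, [sweep_prog], and a single correctness proof,
    [exec_sweep], serve both passes.

    Everything else is a fixed number of loops of length N.  The number of
    operations is bounded by a function [cost] that is computed from the program
    text and the loop bounds; it is at most a constant times N Ne.  The memory bound needs no
    separate analysis: an operation touches at most three cells, so that memory
    is bounded by the size of the input plus three times the number of
    operations ([memory_usage_exec]). *)

(** * Integrals of the derivative of the interpolant *)

Section Integrals.
Context {R : realType}.
Import numFieldNormedType.Exports.
Local Open Scope classical_set_scope.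
Local Notation leb := (@lebesgue_measure R).
Implicit Types (f : R -> R) (a b c mu z s : R).

(** Only the germ of f at y matters, so the formula for the interpolant may be
    used although it holds on one cell only. *)
Lemma derive1_affine_on_open (O : set R) f c d y : open O ->
  (forall t, O t -> f t = c * t + d) -> O y -> derive1 f y = c.
Proof.
move=> oO fE Oy; rewrite derive1E.
have -> : 'D_1 f y = 'D_1 (fun t : R => c * t + d) y.
  apply: near_eq_derive; near=> t; apply: fE; near: t.
  exact: open_nbhs_nbhs.
suff /@derive_val -> : is_derive y 1 (fun t : R => c * t + d) (c%R : R) by [].
apply: is_derive_eq; rewrite addr0.
by rewrite /GRing.scale/= mulr1.
Unshelve. all: by end_near. Qed.

Lemma measurable_exp_piece mu z s : measurable_fun setT
  (fun y : R => expR (- mu * (z - y)) * s).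
Proof.
apply: measurable_funM => //; apply: measurableT_comp => //.
by apply: measurable_funM => //; exact: measurable_funB.
Qed.

Lemma integral_exp_piece mu z s a b : mu != 0 -> a < b ->
  (\int[leb]_(y in `[a, b]) (expR (- mu * (z - y)) * s)%:E)%E =
  (s / mu * (expR (- mu * (z - b)) - expR (- mu * (z - a))))%:E.
Proof.
move=> mu0 ab; pose F := fun y : R => s / mu * expR (- mu * (z - y)).
have dF (y : R) : is_derive y (1 : R) F (expR (- mu * (z - y)) * s).
  rewrite /F; apply: is_derive_eq.
  rewrite /GRing.scale/=; field.
  by [].
have cF : continuous F.
  by move=> y; apply/differentiable_continuous/derivable1_diffP; exact: ex_derive.
rewrite (@continuous_FTC2 _ _ F) //; last 3 first.
- apply: continuous_subspaceT => y.
  by apply/differentiable_continuous/derivable1_diffP; exact: ex_derive.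
- split; first by move=> y _; exact: ex_derive.
  + by apply/cvg_at_right_filter; exact: cF.
  + by apply/cvg_at_left_filter; exact: cF.
- by move=> y _; rewrite derive1E; exact: derive_val.
by rewrite /F [in RHS]mulrBr EFinB.
Qed.

(** Measurability is kept together with the value, because additivity of the
    integral over adjacent intervals requires it; the integrand is the
    derivative of the interpolant, whose values at the nodes are unknown, and so
    it is not given by a closed expression that is obviously measurable. *)
Definition has_integral (D : set R) f c : Prop :=
  measurable_fun D f /\ (\int[leb]_(y in D) (f y)%:E)%E = c%:E.

Lemma has_integral_set1 a f : has_integral [set a] f 0.
Proof.
by split; [exact: measurable_fun_set1 | rewrite integral_set1].
Qed.

Lemma has_integral_cat a b d f c1 c2 : a <= b -> b < d ->
  has_integral `[a, b] f c1 -> has_integral `[b, d] f c2 ->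
  has_integral `[a, d] f (c1 + c2).
Proof.
move=> ab bd [m1 i1] [m2 i2].
have E : `[a, d]%classic = `[a, b]%classic `|` `]b, d]%classic.
  by rewrite -itv_bndbnd_setU// bnd_simp // ltW.
have m2' : measurable_fun `]b, d] f.
  by apply: measurable_funS m2 => //; apply: subset_itvr; rewrite bnd_simp.
have mU : measurable_fun (`[a, b] `|` `]b, d]) f.
  by apply/measurable_funU => //.
split; first by rewrite E.
rewrite E integral_setU //; last 2 first.
- exact/measurable_EFinP.
- apply/disj_setPS => y [/=]; rewrite !in_itv/= => /andP[_ yb] /andP[by_ _].
  by rewrite ltNge yb in by_.
by rewrite i1 integral_itv_obnd_cbnd ?i2 //; exact/measurable_EFinP.
Qed.

(** The integrand is prescribed on the open interval only: its values at the
    two end points, which are nodes of the grid, form a null set. *)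
Lemma has_integral_piece mu z s a b f : mu != 0 -> a < b ->
  (forall y, a < y < b -> f y = expR (- mu * (z - y)) * s) ->
  has_integral `[a, b] f
    (s / mu * (expR (- mu * (z - b)) - expR (- mu * (z - a)))).
Proof.
move=> mu0 ab fE.
have mE D : measurable_fun D (fun y : R => expR (- mu * (z - y)) * s).
  exact: measurable_funTS (measurable_exp_piece mu z s).
have mf : measurable_fun `]a, b[ f.
  apply: eq_measurable_fun (mE _) => y; rewrite inE/= => yab.
  by rewrite fE //; move: yab; rewrite in_itv.
split; first exact: measurable_fun_itv_cc mf.
rewrite (eq_integral_itv_bounded _ _ mf (mE _)) ?integral_exp_piece //.
Qed.

(** Both sides are integrals over the whole line of one and the same function,
    the extension of f by zero.  This is how the unbounded integrals are cut down
    to the grid. *)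
Lemma Rintegral_support D D' f : D' `<=` D ->
  (forall y, D y -> ~ D' y -> f y = 0) ->
  Rintegral leb D f = Rintegral leb D' f.
Proof.
move=> D'D f0; rewrite Rintegral_mkcond [RHS]Rintegral_mkcond.
congr (Rintegral _ _ _); apply/funext => y; rewrite !patchE.
case: ifPn => [/set_mem Dy|/negP nDy]; case: ifPn => [/set_mem D'y|/negP nD'y] //.
- by apply: f0 => // D'y; apply: nD'y; rewrite inE.
- by case: nDy; rewrite inE; apply: D'D.
Qed.

End Integrals.

Section Nonlocal.
Context {R : realType}.
Import numFieldNormedType.Exports.
Local Open Scope classical_set_scope.
Local Notation leb := (@lebesgue_measure R).
Variables (N : nat) (x v : nat -> R).
Hypothesis x_incr : forall j, (j < N)%N -> x j < x j.+1.
Hypotheses (v0 : v 0%N = 0) (vN : v N = 0).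

Lemma grid_lt i j : (i < j)%N -> (j <= N)%N -> x i < x j.
Proof.
elim: j => // j IH; rewrite ltnS leq_eqVlt => /predU1P[-> jN|ij jN].
  exact: x_incr.
exact: lt_trans (IH ij (ltnW jN)) (x_incr jN).
Qed.

Lemma grid_le i j : (i <= j)%N -> (j <= N)%N -> x i <= x j.
Proof.
by rewrite leq_eqVlt => /predU1P[->//|ij jN]; exact/ltW/grid_lt.
Qed.

Lemma hat_out j y : (0 < j < N)%N -> y < x j.-1 \/ x j.+1 < y -> hat x j y = 0.
Proof.
move=> /andP[j0 jN] H; rewrite /hat.
have h1 : x j.-1 < x j by apply: grid_lt => //; lia.
have h2 : x j < x j.+1 by apply: grid_lt => //; lia.
by case: ifPn => [/andP[? ?]|_]; [|case: ifPn => [/andP[? ?]|//]];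
  case: H => ?; exfalso; lra.
Qed.

(** Of all hat functions only those of the two ends of the cell survive there;
    when an end of the cell is an end of the grid, its hat function is absent
    from the interpolant, and v vanishes at that node. *)
Lemma interpolant_piece k y : (k < N)%N -> x k < y < x k.+1 ->
  interpolant N x v y
  = (v k.+1 - v k) / (x k.+1 - x k) * y
    + (v k * x k.+1 - v k.+1 * x k) / (x k.+1 - x k).
Proof.
move=> kN /andP[ky yk].
have hk : 0 < x k.+1 - x k by lra.
have -> : interpolant N x v y =
    \sum_(1 <= j < N) ((if j == k.+1 then v j * ((y - x k) / (x k.+1 - x k)) else 0)
            + (if j == k then v j * ((x k.+1 - y) / (x k.+1 - x k)) else 0)).
  rewrite /interpolant; apply: eq_big_nat => j jN.
  have [->|nk1] := eqVneq j k.+1.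
    rewrite gtn_eqF // addr0 /hat /step /= ltW //= ltW //.
  have [->|nk] := eqVneq j k.
    rewrite add0r /hat /step ifN; first by rewrite (ltW ky) (ltW yk).
    by rewrite negb_and -!ltNge ky orbT.
  rewrite addr0 hat_out ?mulr0 //.
  have [jk|kj] := ltnP j k.
    by right; apply: le_lt_trans ky; apply: grid_le => //; lia.
  by left; apply: lt_le_trans yk _; apply: grid_le; lia.
rewrite big_split /= -!big_mkcond !big_nat1_eq.
have -> : (if (0 < k.+1 < N)%N then v k.+1 * ((y - x k) / (x k.+1 - x k)) else 0)
    = v k.+1 * ((y - x k) / (x k.+1 - x k)).
  case: ifPn => //= kN'; rewrite (_ : k.+1 = N) ?vN ?mul0r //; lia.
have -> : (if (0 < k < N)%N then v k * ((x k.+1 - y) / (x k.+1 - x k)) else 0)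
    = v k * ((x k.+1 - y) / (x k.+1 - x k)).
  case: ifPn => //= kN'; rewrite (_ : k = 0%N) ?v0 ?mul0r //; lia.
by field; lra.
Qed.

Lemma interpolant_out y : y < x 0%N \/ x N < y -> interpolant N x v y = 0.
Proof.
move=> H; rewrite /interpolant big_nat_cond big1 // => j /andP[jN _].
rewrite hat_out ?mulr0 //; case: H => H; [left|right].
  by apply: lt_le_trans H _; apply: grid_le => //; lia.
by apply: le_lt_trans H; apply: grid_le => //; lia.
Qed.

Lemma derive1_interpolant k y : (k < N)%N -> x k < y < x k.+1 ->
  derive1 (interpolant N x v) y = (v k.+1 - v k) / (x k.+1 - x k).
Proof.
move=> kN yk.
apply: (@derive1_affine_on_open _ `]x k, x k.+1[ _ _
  ((v k * x k.+1 - v k.+1 * x k) / (x k.+1 - x k))) => //=.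
by move=> t; rewrite in_itv/= => tk; exact: interpolant_piece.
Qed.

Lemma derive1_interpolant_out y : y < x 0%N \/ x N < y ->
  derive1 (interpolant N x v) y = 0.
Proof.
case=> yx.
  apply: (@derive1_affine_on_open _ `]-oo, x 0%N[ _ _ 0) => //=.
  move=> t; rewrite in_itv/= => tx.
  by rewrite interpolant_out ?mul0r ?addr0 //; left.
apply: (@derive1_affine_on_open _ `]x N, +oo[ _ _ 0) => //=.
  move=> t; rewrite in_itv/= andbT => tx.
  by rewrite interpolant_out ?mul0r ?addr0 //; right.
by rewrite in_itv/= andbT.
Qed.

(** The integral of exp(-mu (z - y)) times the slope of the interpolant, over
    the oriented segment from x_p to x_c.  The nodes p and c are adjacent in
    either order: p is the one which a sweep visits first.  The sign of mu then
    distinguishes the two directions. *)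
Definition kernel_segment mu z p c : R :=
  (v c - v p) / ((x c - x p) * mu)
  * (expR (- mu * (z - x c)) - expR (- mu * (z - x p))).

Lemma kernel_segment_sym mu z p c :
  kernel_segment mu z p c = - kernel_segment mu z c p.
Proof.
rewrite /kernel_segment -[in LHS](opprB (v p)) -[in LHS](opprB (x p)).
rewrite -[in LHS](opprB (expR _)) !(mulNr, invrN, mulrN) !opprK //.
Qed.

Lemma has_integral_interpolant mu z p n : mu != 0 -> (p + n <= N)%N ->
  has_integral `[x p, x (p + n)%N]
    (fun y => expR (- mu * (z - y)) * derive1 (interpolant N x v) y)
    (\sum_(p <= j < p + n) kernel_segment mu z j j.+1).
Proof.
move=> mu0; elim: n => [_|n IH nN].
  by rewrite addn0 big_geq // set_itv1; exact: has_integral_set1.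
rewrite addnS big_nat_recr /=; last exact: leq_addr.
have nN' : (p + n < N)%N by lia.
apply: has_integral_cat (IH (ltnW nN')) _; first by apply: grid_le; lia.
  exact: x_incr.
rewrite /kernel_segment invfM mulrA; apply: has_integral_piece => //.
  exact: x_incr.
by move=> y yk; rewrite (derive1_interpolant nN' yk).
Qed.

Lemma SL_segments lambda i : lambda != 0 -> (i.-1 <= N)%N ->
  SL N x lambda v i = \sum_(0 <= j < i.-1) kernel_segment lambda (x i) j j.+1.
Proof.
move=> l0 iN; rewrite /SL (@Rintegral_support _ _ `[x 0%N, x i.-1]) //; last 2 first.
- by apply: subset_itvr.
- move=> y /=; rewrite !in_itv/= => -> /negP; rewrite andbT -ltNge => yx.
  by rewrite derive1_interpolant_out ?mulr0 //; left.
by rewrite /Rintegral (has_integral_interpolant (p := 0) _ l0 iN).2.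
Qed.

(** The kernel exp(-lambda (y - x_i)) is the left-hand kernel with parameter
    -lambda, and the minus sign in front of the integral reverses the orientation
    of every cell. *)
Lemma SR_segments lambda i : lambda != 0 -> (i < N)%N ->
  SR N x lambda v i
  = \sum_(i.+1 <= j < N) kernel_segment (- lambda) (x i) j.+1 j.
Proof.
move=> l0 iN; rewrite /SR (@Rintegral_support _ _ `[x i.+1, x N]) //; last 2 first.
- by apply: subset_itvl.
- move=> y /=; rewrite !in_itv/= andbT => -> /negP; rewrite -ltNge => yx.
  by rewrite derive1_interpolant_out ?mulr0 //; right.
have l0' : - lambda != 0 by rewrite oppr_eq0.
have := has_integral_interpolant (p := i.+1) (n := N - i.+1) (x i) l0'.
rewrite subnKC // => /(_ (leqnn _)) [_ HI].
under eq_Rintegral do rewrite -(opprB (x i)) mulrN -mulNr.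
rewrite /Rintegral HI -sumrN /=; apply: eq_bigr => j _.
by rewrite -kernel_segment_sym.
Qed.

End Nonlocal.

(** * The nodal values as sums over grid cells *)

Section Segments.
Context {R : realType}.
Implicit Types (x v : nat -> R) (mu z : R) (q : nat -> nat).

(** The sequence q lists the nodes in the order in which a sweep visits them: the
    identity for the sweep from the left, k |-> N - k for the one from the right.
    The sum is seen from the node q (k + 1) and runs over the k cells that the
    sweep has passed before reaching q k; the cell between q k and q (k + 1)
    belongs to the local part of the scheme. *)
Definition sweep_sum x v mu q k : R :=
  \sum_(j < k) kernel_segment x v mu (x (q k.+1)) (q j) (q j.+1).

Lemma kernel_segment_shift x v mu z z' p c :
  kernel_segment x v mu z' p c
  = expR (- mu * (z' - z)) * kernel_segment x v mu z p c.
Proof.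
rewrite /kernel_segment mulrCA; congr (_ * _).
rewrite [RHS]mulrBr -!expRD; congr (expR _ - expR _); ring.
Qed.

(** The recurrence that makes the scheme fast: an exponential kernel propagates
    all earlier contributions by one common factor. *)
Lemma sweep_sumS x v mu q k :
  sweep_sum x v mu q k.+1
  = expR (- mu * (x (q k.+2) - x (q k.+1))) * sweep_sum x v mu q k
    + kernel_segment x v mu (x (q k.+2)) (q k) (q k.+1).
Proof.
rewrite /sweep_sum big_ord_recr /=; congr (_ + _).
by rewrite mulr_sumr; apply: eq_bigr => j _; exact: kernel_segment_shift.
Qed.

Lemma sweep_sum_linear x (a : R) u v mu q k :
  sweep_sum x (fun j => a * u j + v j) mu q k
  = a * sweep_sum x u mu q k + sweep_sum x v mu q k.
Proof.
rewrite /sweep_sum mulr_sumr -big_split; apply: eq_bigr => j _ /=.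
by rewrite /kernel_segment; ring.
Qed.

Variables (N Ne : nat) (alpha : R) (x lambda theta : nat -> R).

(** With this weight the two cases of the scheme take the same form. *)
Definition local_weight (h : R) : R :=
  if alpha == 1 then (1 + ln h) / h
  else h `^ (- alpha) / (alpha * (1 - alpha)).

(** The formula that the program evaluates at node i.  It agrees with [Lh] when
    v vanishes at both ends of the grid. *)
Definition node_value v i : R :=
  Calpha alpha *
  (- local_weight (step x i) * v i.-1
   + (local_weight (step x i) + local_weight (step x i.+1)) * v i
   - local_weight (step x i.+1) * v i.+1
   + 1 / alpha * \sum_(s < Ne) theta s *
       (sweep_sum x v (lambda s) id i.-1
        + sweep_sum x v (- lambda s) (subn N) (N - i.+1))).

Lemma node_value_linear (a : R) u v i :
  node_value (fun j => a * u j + v j) i = a * node_value u i + node_value v i.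
Proof.
rewrite /node_value.
under eq_bigr do rewrite !sweep_sum_linear.
have -> : \sum_(s < Ne) theta s *
   (a * sweep_sum x u (lambda s) id i.-1 + sweep_sum x v (lambda s) id i.-1 +
    (a * sweep_sum x u (- lambda s) (subn N) (N - i.+1) +
     sweep_sum x v (- lambda s) (subn N) (N - i.+1))) =
   a * (\sum_(s < Ne) theta s *
       (sweep_sum x u (lambda s) id i.-1
        + sweep_sum x u (- lambda s) (subn N) (N - i.+1)))
  + \sum_(s < Ne) theta s *
       (sweep_sum x v (lambda s) id i.-1
        + sweep_sum x v (- lambda s) (subn N) (N - i.+1)).
  by rewrite mulr_sumr -big_split; apply: eq_bigr => s _ /=; ring.
ring.
Qed.

Lemma node_value_sum (I : Type) (r : seq I) (c : I -> R) (V : I -> nat -> R) i :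
  node_value (fun k => \sum_(j <- r) c j * V j k) i
  = \sum_(j <- r) c j * node_value (V j) i.
Proof.
elim: r => [|j r IH].
  rewrite big_nil; have := node_value_linear (-1) (fun=> 0) (fun=> 0) i.
  under [in X in node_value X i]eq_fun do rewrite mulr0 addr0.
  under [in X in _ -> node_value X i = _]eq_fun do rewrite big_nil.
  by move=> ->; rewrite mulN1r addNr.
rewrite big_cons -IH -node_value_linear; congr node_value.
by apply/funext => k; rewrite big_cons.
Qed.

Hypothesis x_incr : forall j, (j < N)%N -> x j < x j.+1.
Hypothesis lambda_gt0 : forall s, (s < Ne)%N -> 0 < lambda s.

Lemma Lh_node_value v i : v 0%N = 0 -> v N = 0 -> (0 < i < N)%N ->
  Lh N Ne alpha x lambda theta v i = node_value v i.
Proof.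
move=> v0 vN /andP[i0 iN].
rewrite /Lh /node_value; congr (_ * _).
have -> : nonlocal N Ne x lambda theta v i = \sum_(s < Ne) theta s *
       (sweep_sum x v (lambda s) id i.-1
        + sweep_sum x v (- lambda s) (subn N) (N - i.+1)).
  apply: eq_bigr => s _; have l0 := lambda_gt0 (ltn_ord s).
  rewrite (SL_segments x_incr) ?(gt_eqF l0) //; last by lia.
  rewrite (SR_segments x_incr) ?(gt_eqF l0) //.
  congr (_ * (_ + _)).
    by rewrite big_mkord /sweep_sum prednK.
  (* The sweep from the right meets the cells in decreasing order. *)
  rewrite big_nat_rev -{1}(add0n i.+1) big_addn big_mkord /sweep_sum.
  apply: eq_bigr => j _; have jN := ltn_ord j.
  congr kernel_segment; first congr x; lia.
rewrite /local_weight; case: eqP => _; first by rewrite mulNr.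
congr (_ + _).
set A := _ `^ _; set B := _ `^ _; set D := alpha * _.
by rewrite -[1 / D]/(1 * D^-1) mul1r; ring.
Qed.

Lemma extend_last (g : 'cV[R]_N.-1) : (0 < N)%N -> extend g N = 0.
Proof.
by case: N g => // n g _; rewrite /extend insubF //= ltnn.
Qed.

Lemma extend_delta (g : 'cV[R]_N.-1) k :
  extend g k = \sum_(j < N.-1) g j ord0 * extend (delta_mx j ord0) k.
Proof.
case: k => [|k] /=; first by rewrite big1 // => j _; rewrite mulr0.
case: insubP => [j _ jk|_] /=; last by rewrite big1 // => j _; rewrite mulr0.
rewrite (bigD1 j) //= mxE !eqxx mulr1 big1 ?addr0 // => i ij.
by rewrite mxE eq_sym (negPf ij) mulr0.
Qed.

(** The columns of the matrix are the nodal values of the unit vectors, which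
    vanish at both ends of the grid; linearity carries this over to g. *)
Lemma mulmx_coef_mx (g : 'cV[R]_N.-1) (i : 'I_N.-1) : (0 < N)%N ->
  (coef_mx N Ne alpha x lambda theta *m g) i ord0 = node_value (extend g) i.+1.
Proof.
move=> N0; rewrite mxE.
rewrite (funext (extend_delta g)).
rewrite node_value_sum; apply: eq_bigr => j _; rewrite mxE mulrC.
rewrite Lh_node_value //; first exact: extend_last.
by have := ltn_ord i; lia.
Qed.

End Segments.

(** * Resource bounds read off a program *)

(* The field [mem] of a machine state is hidden behind the homonymous
   membership predicate of sequences. *)
Notation memory := Defs.mem (only parsing).

Lemma iteri_inv (T : Type) (P : nat -> T -> Prop) (f : nat -> T -> T) n t :
  P 0%N t -> (forall k t', (k < n)%N -> P k t' -> P k.+1 (f k t')) ->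
  P n (iteri n f t).
Proof.
move=> P0 PS; suff H k : (k <= n)%N -> P k (iteri k f t) by exact: H.
by elim: k => // k IH kn; apply: PS => //; apply: IH; exact: ltnW.
Qed.

Section Resources.
Context {R : realType}.
Variables N Ne : nat.

Fixpoint written_arrays (p : program) : seq nat :=
  match p with
  | Skip => [::]
  | Set0 d _ | Set1 d _ _ | Set2 d _ _ _ => [:: d.1]
  | Seq p1 p2 | IfLe _ _ p1 p2 => written_arrays p1 ++ written_arrays p2
  | For _ p1 => written_arrays p1
  end.

(** Since arrays are disjoint and named in the program text, this single fact
    settles that a later phase leaves the results of the earlier ones intact. *)
Lemma exec_frame p env (st : @state R) c :
  c.1 \notin written_arrays p -> memory (exec N Ne p env st) c = memory st c.
Proof.
have upd (env' : seq nat) (d : address) (r : R) m :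
    c.1 \notin [:: d.1] -> update m (address_sem N Ne env' d) r c = m c.
  by rewrite inE /update /address_sem; have [->|//] := eqVneq c; rewrite eqxx.
elim: p env st => [|d k|d o a|d o a b|p1 IH1 p2 IH2|a b p1 IH1 p2 IH2|e p1 IH1]
    env st //= cp.
- exact: upd.
- exact: upd.
- exact: upd.
- move: cp; rewrite mem_cat negb_or => /andP[c1 c2].
  by rewrite IH2 ?IH1.
- move: cp; rewrite mem_cat negb_or => /andP[c1 c2].
  by case: ifP => _; rewrite ?IH1 ?IH2.
- apply: (@iteri_inv _ (fun _ st' => memory st' c = memory st c)) => // k st' _ <-.
  exact: IH1.
Qed.

Fixpoint cost (p : program) (env : seq nat) : nat :=
  match p with
  | Skip => 0
  | Set0 _ _ | Set1 _ _ _ | Set2 _ _ _ _ => 1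
  | Seq p1 p2 => cost p1 env + cost p2 env
  | IfLe _ _ p1 p2 => (maxn (cost p1 env) (cost p2 env)).+1
  | For e p1 => \sum_(k < index_sem N Ne env e) cost p1 (val k :: env)
  end.

Lemma ops_exec p env (st : @state R) :
  (ops (exec N Ne p env st) <= ops st + cost p env)%N.
Proof.
elim: p env st => [|d k|d o a|d o a b|p1 IH1 p2 IH2|a b p1 IH1 p2 IH2|e p1 IH1]
    env st //=; rewrite ?addn0 ?addn1 //.
- by rewrite addnA; apply: leq_trans (IH2 _ _) _; rewrite leq_add2r.
- case: ifP => _; [apply: leq_trans (IH1 _ _) _ | apply: leq_trans (IH2 _ _) _];
    rewrite /= addSnnS leq_add2l ltnS; [exact: leq_maxl | exact: leq_maxr].
- rewrite -(big_mkord xpredT (fun k => cost p1 (k :: env))).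
  apply: (@iteri_inv _ (fun n st' => (ops st' <= ops st
    + \sum_(0 <= k < n) cost p1 (k :: env))%N)) => [|k st' _ IH].
    by rewrite big_geq // addn0.
  rewrite big_nat_recr //= addnA; apply: leq_trans (IH1 _ _) _.
  by rewrite leq_add2r.
Qed.

(** Every operation adds at most three cells to the list: a target and two
    arguments.  Both differences are moved to the other side, because subtraction of
    natural numbers is truncated. *)
Lemma touched_exec p env (st : @state R) :
  (size (touched (exec N Ne p env st)) + 3 * ops st
   <= size (touched st) + 3 * ops (exec N Ne p env st))%N.
Proof.
elim: p env st => [|d k|d o a|d o a b|p1 IH1 p2 IH2|a b p1 IH1 p2 IH2|e p1 IH1]
    env st //=; try lia.
- by have := IH1 env st; have := IH2 env (exec N Ne p1 env st); lia.
- set st' := State _ _ _.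
  by case: ifP => _; [have := IH1 env st' | have := IH2 env st']; rewrite /=; lia.
- apply: (@iteri_inv _ (fun _ st' => (size (touched st') + 3 * ops st
    <= size (touched st) + 3 * ops st')%N)) => // k st' _.
  by have := IH1 (k :: env) st'; lia.
Qed.

Lemma memory_usage_exec p env (st : @state R) : ops st = 0%N ->
  (memory_usage (exec N Ne p env st) <= size (touched st) + 3 * cost p env)%N.
Proof.
move=> st0; apply: leq_trans (size_undup _) _.
have ops_le := ops_exec p env st; have := touched_exec p env st.
rewrite st0 muln0 addn0 => le; apply: leq_trans le _.
by rewrite leq_add2l leq_mul2l /=; move: ops_le; rewrite st0.
Qed.

End Resources.

(** * Arithmetic expressions *)

(** The machine only has instructions with at most two arguments.  Formulas are
    written as trees and translated to instructions that keep the intermediate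
    results on a stack in a scratch array; entries of depth less than d are in
    use while the code of [compile d e] runs. *)
Inductive expr : Type :=
| Read of address
| Const of const
| App1 of unop & expr
| App2 of binop & expr & expr.

Notation scratch := 12%N (only parsing).

Fixpoint compile (d : nat) (e : expr) : program :=
  let r := (scratch, INum d) in
  match e with
  | Read a => Set1 r Copy a
  | Const c => Set0 r c
  | App1 o e1 => Seq (compile d e1) (Set1 r o r)
  | App2 o e1 e2 =>
      Seq (compile d e1)
        (Seq (compile d.+1 e2) (Set2 r o r (scratch, INum d.+1)))
  end.

Definition store_expr (a : address) (e : expr) : program :=
  Seq (compile 0 e) (Set1 a Copy (scratch, INum 0)).

Fixpoint read_arrays (e : expr) : seq nat :=
  match e with
  | Read a => [:: a.1]
  | Const _ => [::]
  | App1 _ e1 => read_arrays e1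
  | App2 _ e1 e2 => read_arrays e1 ++ read_arrays e2
  end.

Section Expressions.
Context {R : realType}.
Variables N Ne : nat.

Fixpoint eval (env : seq nat) (m : @store R) (e : expr) : R :=
  match e with
  | Read a => m (address_sem N Ne env a)
  | Const c => const_sem c
  | App1 o e1 => unop_sem o (eval env m e1)
  | App2 o e1 e2 => binop_sem o (eval env m e1) (eval env m e2)
  end.

Lemma eq_eval env (m m' : @store R) e :
  (forall c, c.1 \in read_arrays e -> m c = m' c) -> eval env m e = eval env m' e.
Proof.
elim: e => [a|c|o e1 IH1|o e1 IH1 e2 IH2] //= H.
- by apply: H; rewrite inE eqxx.
- by rewrite IH1.
- by rewrite IH1 ?IH2 // => c ce; apply: H; rewrite mem_cat ce ?orbT.
Qed.

(** The second part, that the stack below d is preserved, is what the induction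
    needs: the value of a left operand must survive the evaluation of the right
    one. *)
Lemma exec_compile env e d (st : @state R) : scratch \notin read_arrays e ->
  let st' := exec N Ne (compile d e) env st in
  memory st' (scratch, d) = eval env (memory st) e
  /\ forall c, (c.1 != scratch) || (c.2 < d)%N -> memory st' c = memory st c.
Proof.
have keep (m : @store R) k (r : R) c : (c.1 != scratch) || (c.2 < k)%N ->
    update m (scratch, k) r c = m c.
  by rewrite /update; have [->|//] := eqVneq c; rewrite /= ltnn.
elim: e d st => [a|k|o e1 IH1|o e1 IH1 e2 IH2] d st /=.
- by move=> _; split=> [|c]; [rewrite /update eqxx | exact: keep].
- by move=> _; split=> [|c]; [rewrite /update eqxx | exact: keep].
- move=> r1; have [/= v1 f1] := IH1 d st r1; split=> [|c cd].
    by rewrite /update eqxx /address_sem /= v1.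
  by rewrite keep // f1.
- rewrite mem_cat negb_or => /andP[r1 r2].
  have [/= v1 f1] := IH1 d st r1.
  have [/= v2 f2] := IH2 d.+1 (exec N Ne (compile d e1) env st) r2.
  split=> [|c cd].
    rewrite /update eqxx /address_sem /= v2 f2 /= ?ltnS ?leqnn ?orbT // v1.
    congr binop_sem; apply: eq_eval => c ce; apply: f1.
    by apply/orP; left; move: ce; apply: contraTneq => ->.
  rewrite keep // f2 ?f1 //.
  by case/orP: cd => [->//|/ltnW cd]; rewrite ltnS cd orbT.
Qed.

Lemma exec_store_expr env a e (st : @state R) c :
  scratch \notin read_arrays e -> c.1 != scratch ->
  memory (exec N Ne (store_expr a e) env st) c
  = if c == address_sem N Ne env a then eval env (memory st) e else memory st c.
Proof.
move=> se cs; have [/= v1 f1] := exec_compile env 0 st se.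
by rewrite /update /=; case: eqP => // _; rewrite f1 // cs.
Qed.

Lemma written_compile d e : {subset written_arrays (compile d e) <= [:: scratch]}.
Proof.
elim: e d => [a|k|o e1 IH1|o e1 IH1 e2 IH2] d i //=.
  by rewrite mem_cat => /orP[/IH1|].
by rewrite !mem_cat => /orP[/IH1|/orP[/IH2|]].
Qed.

(** When the expression does not read the array that is being filled, the order
    of the assignments is irrelevant, and every entry is the value of the
    expression in the initial state. *)
Lemma exec_fill env n a e (st : @state R) :
  let f k := index_sem N Ne (k :: env) a.2 in
  let st' := exec N Ne (For n (store_expr a e)) env st in
  scratch \notin read_arrays e -> a.1 \notin read_arrays e -> a.1 != scratch ->
  {in gtn (index_sem N Ne env n) &, injective f} ->
  (forall k, (k < index_sem N Ne env n)%N ->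
     memory st' (a.1, f k) = eval (k :: env) (memory st) e)
  /\ (forall j, (forall k, (k < index_sem N Ne env n)%N -> f k != j) ->
     memory st' (a.1, j) = memory st (a.1, j)).
Proof.
move=> f st' se ae sa f_inj.
have H := @iteri_inv _ (fun k st'' =>
  [/\ forall i, (i < k)%N -> memory st'' (a.1, f i) = eval (i :: env) (memory st) e,
     forall j, (forall i, (i < k)%N -> f i != j) ->
       memory st'' (a.1, j) = memory st (a.1, j) &
     forall c, c.1 != a.1 -> c.1 != scratch -> memory st'' c = memory st c])
  (fun k => exec N Ne (store_expr a e) (k :: env)) (index_sem N Ne env n) st.
have [] := H _ _; [by []| |by move=> h1 h2 _; split].
move=> k st1 kn [h1 h2 h3]; split=> [i|j fj|c ca cs].
- rewrite ltnS => ik; rewrite exec_store_expr // xpair_eqE eqxx /=.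
  case: eqP => [fik|nfik].
    have -> : i = k by apply: f_inj => //; apply: leq_ltn_trans kn.
    apply: eq_eval => c ce; apply: h3.
      by move: ce; apply: contraTneq => ->.
    by move: ce; apply: contraTneq => ->.
  apply: h1; rewrite ltn_neqAle ik andbT.
  by apply/eqP => ik'; case: nfik; rewrite ik'.
- rewrite exec_store_expr // xpair_eqE eqxx /= ifN; last by rewrite eq_sym fj.
  by apply: h2 => i ik; apply: fj; exact: ltnW.
- by rewrite exec_store_expr // ifN ?h3 //; apply: contraNneq ca => ->.
Qed.

End Expressions.

(** * The program *)

Declare Scope expr_scope.
Delimit Scope expr_scope with X.
Bind Scope expr_scope with expr.
Notation "a + b" := (App2 Add a b) : expr_scope.
Notation "a - b" := (App2 Defs.Sub a b) : expr_scope.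
Notation "a * b" := (App2 Mul a b) : expr_scope.
Notation "a / b" := (App2 Div a b) : expr_scope.
Notation "a `^ b" := (App2 Pow a b) : expr_scope.
Notation lit z := (Const (Int z%Z)) (only parsing).
Notation "- a" := (lit 0 - a)%X : expr_scope.

(** Arrays 0 to 5 hold the input and the output.  The others are: 6, the values
    v_0, ..., v_N; 7, the parameter mu of the current sweep; 8, its running sum;
    9, the nonlocal sums, accumulated by node; 10, the local weights, by the right
    end of the cell; 11, the constant C_alpha; 12, the evaluation stack; 13, the
    number 1, with which alpha is compared. *)
Definition reg (a : nat) : address := (a, INum 0).
Definition at_offset (a j : nat) : address := (a, IAdd (IVar 0) (INum j)).

Notation alpha_reg := (reg 0).
Notation C_reg := (reg 11).
Notation mu_reg := (reg 7).
Notation sum_reg := (reg 8).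
Notation one_reg := (reg 13).

Definition Calpha_expr : expr :=
  let alpha := Read alpha_reg in
  (alpha * lit 2 `^ (alpha - lit 1)
     * App1 GammaFun ((lit 1 + alpha) / lit 2)
   / (Const Pi `^ (lit 1 / lit 2) * App1 GammaFun (lit 1 - alpha / lit 2)))%X.

Definition step_expr : expr := (Read (at_offset 1 1) - Read (at_offset 1 0))%X.

Definition log_weight_expr : expr :=
  ((lit 1 + App1 Ln step_expr) / step_expr)%X.

Definition pow_weight_expr : expr :=
  let alpha := Read alpha_reg in
  (step_expr `^ (- alpha) / (alpha * (lit 1 - alpha)))%X.

Definition weights_prog : program :=
  Seq (store_expr one_reg (lit 1))
    (IfLe alpha_reg one_reg
      (For IN (store_expr (at_offset 10 1) log_weight_expr))
      (For IN (store_expr (at_offset 10 1) pow_weight_expr))).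

(** The right-hand side of the recurrence for [sweep_sum]; q 0, q 1 and q 2 are the
    previous, the current and the next node of the sweep. *)
Definition sweep_step_expr (q : nat -> Defs.index) : expr :=
  let mu := Read mu_reg in
  let x j := Read (1%N, q j) in
  let v j := Read (6%N, q j) in
  let decay i j := App1 Exp (- mu * (x i - x j))%X in
  (decay 2%N 1%N * Read sum_reg
   + (v 1%N - v 0%N) / ((x 1%N - x 0%N) * mu)
     * (decay 2%N 1%N - decay 2%N 0%N))%X.

(** The index transformation qi and the expression mu select the direction.  A
    round uses the running sum before it advances it, because no cell lies beyond
    the neighbour of the first node, where the sum is empty. *)
Definition sweep_prog (qi : Defs.index -> Defs.index) (mu : expr) : program :=
  let q j := qi (IAdd (IVar 0) (INum j)) in
  let acc := (9%N, q 1%N) in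
  Seq (store_expr mu_reg mu)
    (Seq (store_expr sum_reg (lit 0))
      (For (ISub IN (INum 1))
        (Seq
          (store_expr acc (Read acc + Read (3%N, IVar 1) * Read sum_reg)%X)
          (store_expr sum_reg (sweep_step_expr q))))).

Definition nonlocal_prog : program :=
  let lambda := Read (2%N, IVar 0) in
  For INe (Seq (sweep_prog id lambda) (sweep_prog (ISub IN) (- lambda)%X)).

Definition output_expr : expr :=
  let w j := Read (at_offset 10 j) in
  let v j := Read (at_offset 6 j) in
  (Read C_reg
   * (- w 1%N * v 0%N + (w 1%N + w 2%N) * v 1%N - w 2%N * v 2%N
      + lit 1 / Read alpha_reg * Read (at_offset 9 1)))%X.

(** Entries of array 4 beyond the input are zero, and so is every entry that was
    never written; this provides v_0 = v_N = 0. *)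
Definition matvec_prog : program :=
  Seq (For (ISub IN (INum 1))
        (store_expr (at_offset 6 1) (Read (at_offset 4 0))))
  (Seq (store_expr C_reg Calpha_expr)
  (Seq weights_prog
  (Seq nonlocal_prog
    (For (ISub IN (INum 1)) (store_expr (at_offset 5 0) output_expr))))).

(** The program text contains fewer than 200 instructions, and each of them is
    executed at most N Ne times, because N and Ne are positive. *)
Lemma cost_matvec_prog N Ne : (0 < N)%N -> (0 < Ne)%N ->
  (cost N Ne matvec_prog [::] <= 200 * (N * Ne))%N.
Proof.
move=> N0 Ne0; rewrite /= !sum_nat_const !card_ord.
nia.
Qed.

(** * Correctness of the program *)

Section Correctness.
Context {R : realType}.
Variables (N Ne : nat) (alpha : R) (x v lambda theta : nat -> R).

Definition holds_data (st : @state R) : Prop :=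
  [/\ memory st (0, 0)%N = alpha,
      forall k, (k <= N)%N -> memory st (1, k)%N = x k,
      forall s, (s < Ne)%N -> memory st (2, s)%N = lambda s &
      forall s, (s < Ne)%N -> memory st (3, s)%N = theta s].

Definition holds_nodal_values (st : @state R) : Prop :=
  forall k, (k <= N)%N -> memory st (6, k)%N = v k.

Lemma holds_data_exec p env st : all (leq 4) (written_arrays p) ->
  holds_data st -> holds_data (exec N Ne p env st).
Proof.
move=> /allP p4 [h0 h1 h2 h3].
have fr (a : nat) k : (a < 4)%N ->
    memory (exec N Ne p env st) (a, k) = memory st (a, k).
  move=> a4; apply: exec_frame => /=; apply/negP => /p4.
  by rewrite leqNgt a4.
by split=> [|k kN|s sN|s sN]; rewrite fr //; auto.
Qed.

Lemma holds_data_store_expr a e env st : (4 <= a.1)%N ->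
  holds_data st -> holds_data (exec N Ne (store_expr a e) env st).
Proof.
move=> a4; apply: holds_data_exec; rewrite all_cat /= a4 /= andbT.
by apply/allP => i /written_compile; rewrite inE => /eqP ->.
Qed.

Lemma exec_Calpha st : holds_data st ->
  memory (exec N Ne (store_expr C_reg Calpha_expr) [::] st) (11, 0)%N
  = Calpha alpha.
Proof.
case=> h0 _ _ _.
rewrite (@exec_store_expr R N Ne _ _ Calpha_expr _ (11, 0)%N isT isT) eqxx.
rewrite /Calpha_expr /eval /binop_sem /unop_sem /const_sem [address_sem _ _ _ _]/=.
rewrite h0 -!pmulrn !mulr1n.
by [].
Qed.

Lemma eval_step_expr k st : holds_data st -> (k < N)%N ->
  eval N Ne [:: k] (memory st) step_expr = step x k.+1.
Proof.
move=> [_ h1 _ _] kN; rewrite /= /address_sem /= addn1 addn0 !h1 //.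
exact: ltnW.
Qed.

Lemma exec_weights st k : 1 <= alpha -> holds_data st -> (k < N)%N ->
  memory (exec N Ne weights_prog [::] st) (10, k.+1)%N
  = local_weight alpha (step x k.+1).
Proof.
move=> alpha1 st_data kN.
set st1 := exec N Ne (store_expr one_reg (lit 1)) [::] st.
have st1_data : holds_data st1 by exact: holds_data_exec.
pose st2 := State (memory st1) (ops st1).+1
  [:: (0, 0)%N, (13, 0)%N & touched st1].
have st2_data : holds_data st2 by [].
have inj : {in gtn N &, injective (fun k => k + 1)%N} by move=> i j _ _ /addIn.
have [h0 _ _ _] := st1_data.
have -> : exec N Ne weights_prog [::] st
  = if memory st1 (0, 0)%N <= memory st1 (13, 0)%N
    then exec N Ne (For IN (store_expr (at_offset 10 1) log_weight_expr)) [::] st2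
    else exec N Ne (For IN (store_expr (at_offset 10 1) pow_weight_expr)) [::] st2.
  by [].
have -> : memory st1 (13, 0)%N = 1 by rewrite /st1 exec_store_expr.
rewrite h0 -(addn1 k) /local_weight eq_le alpha1 andbT.
case: ifP => _.
  have [H _] := @exec_fill R N Ne [::] IN (at_offset 10 1) log_weight_expr
    st2 isT isT isT inj; apply: etrans (H k kN) _.
  by rewrite addn1 -(eval_step_expr st2_data kN).
have [H _] := @exec_fill R N Ne [::] IN (at_offset 10 1) pow_weight_expr
  st2 isT isT isT inj; apply: etrans (H k kN) _.
by rewrite addn1 -(eval_step_expr st2_data kN) -h0 -[X in _ `^ X]sub0r.
Qed.

(** Before round k the running sum is [sweep_sum] at k, and exactly the nodes
    q 1, ..., q k have received their contribution; injectivity of q ensures that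
    no node receives two. *)
Lemma exec_sweep st s qi q muE mu :
  (forall env e, index_sem N Ne env (qi e) = q (index_sem N Ne env e)) ->
  {in iota 0 N.+1 &, injective q} -> (forall k, (k <= N)%N -> (q k <= N)%N) ->
  holds_data st -> holds_nodal_values st -> (s < Ne)%N ->
  scratch \notin read_arrays muE -> eval N Ne [:: s] (memory st) muE = mu ->
  forall k, (k.+1 < N)%N ->
  memory (exec N Ne (sweep_prog qi muE) [:: s] st) (9, q k.+1)%N
  = memory st (9, q k.+1)%N + theta s * sweep_sum x v mu q k.
Proof.
move=> qiE q_inj qN st_data st_v sNe mu_fresh muE_mu.
pose st1 := exec N Ne (store_expr mu_reg muE) [:: s] st.
pose st2 := exec N Ne (store_expr sum_reg (lit 0)) [:: s] st1.
pose body := Seq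
  (store_expr (9%N, qi (IAdd (IVar 0) (INum 1)))
    (Read (9%N, qi (IAdd (IVar 0) (INum 1))) + Read (3%N, IVar 1) * Read sum_reg)%X)
  (store_expr sum_reg (sweep_step_expr (fun j => qi (IAdd (IVar 0) (INum j))))).
rewrite [exec _ _ _ _ _](_ : _ = iteri (N - 1)
  (fun k => exec N Ne body [:: k; s]) st2) //.
pose P n st' :=
  [/\ holds_data st', holds_nodal_values st', memory st' (7, 0)%N = mu,
     memory st' (8, 0)%N = sweep_sum x v mu q n &
     (forall k, (k < n)%N -> memory st' (9, q k.+1)%N
        = memory st (9, q k.+1)%N + theta s * sweep_sum x v mu q k) /\
     (forall k, (n <= k)%N -> (k.+1 < N)%N ->
        memory st' (9, q k.+1)%N = memory st (9, q k.+1)%N)].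
suff [_ _ _ _ [H _]] :
    P (N - 1)%N (iteri (N - 1) (fun k => exec N Ne body [:: k; s]) st2).
  by move=> k kN; apply: H; lia.
apply: iteri_inv => [|k st' kN [d' v' mu' S' [acc' acc0']]].
  split.
  - by do 2 apply: holds_data_store_expr => //.
  - by move=> k kN; rewrite /st2 /st1 !exec_store_expr //; exact: st_v.
  - by rewrite /st2 /st1 !exec_store_expr.
  - by rewrite /st2 exec_store_expr // /sweep_sum big_ord0.
  - by split=> // k _ _; rewrite /st2 /st1 !exec_store_expr.
have q0 j : index_sem N Ne [:: k; s] (qi (IAdd (IVar 0) (INum j))) = q (k + j)%N.
  by rewrite qiE.
pose a := exec N Ne (store_expr (9%N, qi (IAdd (IVar 0) (INum 1)))
    (Read (9%N, qi (IAdd (IVar 0) (INum 1)))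
     + Read (3%N, IVar 1) * Read sum_reg)%X) [:: k; s] st'.
have a_frame (c : cell) : c.1 != 9%N -> c.1 != 12%N -> memory a c = memory st' c.
  move=> c9 c12; rewrite /a exec_store_expr // ifN //.
  by apply: contraNneq c9 => ->.
have [_ x' _ th'] := d'.
have a_data : holds_data a by exact: holds_data_store_expr.
have a_acc i : memory a (9, i)%N = if i == q k.+1
    then memory st' (9, i)%N + theta s * sweep_sum x v mu q k
    else memory st' (9, i)%N.
  rewrite /a exec_store_expr // xpair_eqE /= q0 addn1; case: eqP => // ->.
  by rewrite /= /address_sem /= q0 addn1 S' th'.
have -> : exec N Ne body [:: k; s] st' = exec N Ne (store_expr sum_reg
  (sweep_step_expr (fun j => qi (IAdd (IVar 0) (INum j))))) [:: k; s] a by [].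
clearbody a; split.
- exact: holds_data_store_expr.
- by move=> i iN; rewrite exec_store_expr //= a_frame //; exact: v'.
- by rewrite exec_store_expr //= a_frame.
- rewrite exec_store_expr // eqxx.
  rewrite /= /address_sem /= !q0 !a_frame // S' mu' addn0 addn1 addn2.
  rewrite !x' ?v' ?qN //; try lia.
  by rewrite sweep_sumS sub0r.
split=> i ik.
  rewrite exec_store_expr // a_acc.
  have [qik|qik] := eqVneq (q i.+1) (q k.+1).
    have -> : i = k.
      by apply/succn_inj/q_inj; rewrite ?mem_iota //; lia.
    by rewrite acc0' //; lia.
  apply: acc'; rewrite ltn_neqAle -ltnS ik andbT.
  by apply: contraNneq qik => ->.
move=> iN; rewrite exec_store_expr // a_acc ifN.
  by apply: acc0' => //; exact: ltnW.
apply/eqP => qik; have ik' : i.+1 = k.+1.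
  by apply: q_inj => //; rewrite mem_iota; lia.
by lia.
Qed.

(** The sweep from the left visits node i in round i - 1, the one from the right
    in round N - (i + 1). *)
Lemma exec_nonlocal st i : holds_data st -> holds_nodal_values st ->
  (forall k, memory st (9, k)%N = 0) -> (0 < i < N)%N ->
  memory (exec N Ne nonlocal_prog [::] st) (9, i)%N
  = \sum_(s < Ne) theta s *
      (sweep_sum x v (lambda s) id i.-1
       + sweep_sum x v (- lambda s) (subn N) (N - i.+1)).
Proof.
move=> st_data st_v acc0 iN.
pose F s k := theta s * (sweep_sum x v (lambda s) id k.-1
  + sweep_sum x v (- lambda s) (subn N) (N - k.+1)).
rewrite -[RHS]/(\sum_(s < Ne) F (val s) i).
rewrite -(big_mkord xpredT (fun s => F s i)).
pose P n st' := [/\ holds_data st', holds_nodal_values st' &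
  forall k, (0 < k < N)%N -> memory st' (9, k)%N = \sum_(0 <= s < n) F s k].
suff [_ _ -> //] : P Ne (exec N Ne nonlocal_prog [::] st) by [].
apply: iteri_inv => [|s st' sNe [d' v' acc']].
  by split=> // k _; rewrite big_geq.
pose a := exec N Ne (sweep_prog id (Read (2%N, IVar 0))) [:: s] st'.
change (P s.+1 (exec N Ne
  (sweep_prog (ISub IN) (- Read (2%N, IVar 0))%X) [:: s] a)).
have ad : holds_data a by exact: holds_data_exec.
have av : holds_nodal_values a.
  by move=> k kN; rewrite /a exec_frame //; exact: v'.
have lambda_s : memory st' (2, s)%N = lambda s by case: d' => _ _ ->.
have lambda_a : memory a (2, s)%N = lambda s by case: ad => _ _ ->.
have a_acc k : (0 < k < N)%N ->
    memory a (9, k)%N = memory st' (9, k)%N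
      + theta s * sweep_sum x v (lambda s) id k.-1.
  case: k => // k /= kN; rewrite /a.
  by rewrite (@exec_sweep _ _ _ id _ (lambda s)) // => i' j _ _.
clearbody a; split.
- exact: holds_data_exec.
- by move=> k kN; rewrite exec_frame //; exact: av.
move=> k /andP[k0 kN].
have -> : k = (N - (N - k.+1).+1)%N by lia.
rewrite (@exec_sweep _ _ _ (subn N) _ (- lambda s)) //; last 4 first.
- by move=> i' j; rewrite !mem_iota => ? ? ?; lia.
- by move=> k' _; exact: leq_subr.
- by rewrite /= /address_sem /= lambda_a sub0r.
- by lia.
have -> : (N - (N - k.+1).+1)%N = k by lia.
rewrite a_acc ?k0 // acc' ?k0 // big_nat_recr //= /F mulrDr addrA.
by rewrite -addrA.
Qed.

End Correctness.

(** * The initial store *)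

Section Load.
Context {R : realType}.

Notation load_entries m s :=
  (foldr (fun (e : cell * R) m' => update m' e.1 e.2) m s).

Lemma load_entries_out (I : Type) (a : nat) (h : I -> nat) (f : I -> R)
    (r : seq I) m c :
  c.1 != a \/ c.2 \notin [seq h j | j <- r] ->
  load_entries m [seq ((a, h j), f j) | j <- r] c = m c.
Proof.
elim: r => //= j r IH H; rewrite /update /= ifN ?IH //.
  by case: H => [|]; [left | rewrite inE negb_or => /andP[_]; right].
case: H; first by apply: contraNneq => ->.
by rewrite inE negb_or => /andP[+ _]; apply: contraNneq => ->.
Qed.

Lemma load_entries_in (I : eqType) (a : nat) (h : I -> nat) (f : I -> R)
    (r : seq I) m j :
  injective h -> j \in r ->
  load_entries m [seq ((a, h j), f j) | j <- r] (a, h j) = f j.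
Proof.
move=> h_inj; elim: r => //= i r IH; rewrite inE /update /= xpair_eqE eqxx /=.
by rewrite (inj_eq h_inj); case: eqP => [->|_ /IH].
Qed.

Lemma update_eq (m : store) c (r : R) : update m c r c = r.
Proof. by rewrite /update eqxx. Qed.

Lemma update_neq (m : store) c c' (r : R) : c' != c -> update m c r c' = m c'.
Proof. by rewrite /update => /negPf ->. Qed.

Variables (N Ne : nat) (alpha : R) (x lambda theta : nat -> R) (g : 'cV[R]_N.-1).

Let st0 := load (input Ne alpha x lambda theta g).

Lemma mem_load_input : memory st0 =
  update
    (load_entries
      (load_entries
        (load_entries
          (load_entries (fun=> 0)
            [seq ((4, val j)%N, g j ord0) | j <- enum 'I_N.-1])
          [seq ((3, s)%N, theta s) | s <- iota 0 Ne])
        [seq ((2, s)%N, lambda s) | s <- iota 0 Ne])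
      [seq ((1, k)%N, x k) | k <- iota 0 N.+1])
    (0, 0)%N alpha.
Proof. by rewrite -!foldr_cat -!catA. Qed.

Lemma load_data : holds_data N Ne alpha x lambda theta st0.
Proof.
rewrite /holds_data mem_load_input; split.
- exact: update_eq.
- move=> k kN; rewrite update_neq //.
  by apply: (@load_entries_in _ 1 id x) => //; rewrite mem_iota.
- move=> s sN; rewrite update_neq // load_entries_out; last by left.
  by apply: (@load_entries_in _ 2 id lambda) => //; rewrite mem_iota.
- move=> s sN; rewrite update_neq // 2?load_entries_out; try by left.
  by apply: (@load_entries_in _ 3 id theta) => //; rewrite mem_iota.
Qed.

Lemma load_vector k : memory st0 (4, k)%N = extend g k.+1.
Proof.
rewrite mem_load_input update_neq // 3?load_entries_out; try by left.
rewrite /extend; case: insubP => [j _ <-|kN].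
  apply: (@load_entries_in _ 4 val (fun j => g j ord0)); first exact: val_inj.
  by rewrite mem_enum.
by rewrite load_entries_out //; right; rewrite val_enum_ord mem_iota.
Qed.

Lemma load_zero a k : (4 < a)%N -> memory st0 (a, k) = 0.
Proof.
move=> a4; rewrite mem_load_input update_neq.
  by rewrite 4?load_entries_out //; left; rewrite /= gtn_eqF //; lia.
by rewrite xpair_eqE gtn_eqF //; lia.
Qed.

Lemma size_input : (0 < N)%N ->
  size (input Ne alpha x lambda theta g) = (2 * N + 2 * Ne + 1)%N.
Proof.
move=> N0; rewrite /input -cat1s !size_cat !size_map !size_iota.
rewrite -enumT size_enum_ord /=; lia.
Qed.

End Load.


(** * The matrix-vector product *)

Section MatVec.
Context {R : realType}.
Variables (N Ne : nat) (alpha : R) (x lambda theta : nat -> R) (g : 'cV[R]_N.-1).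

Lemma run_matvec_prog i : (0 < N)%N -> 1 <= alpha -> (i < N.-1)%N ->
  memory (run N Ne matvec_prog (input Ne alpha x lambda theta g)) (5, i)%N
  = node_value N Ne alpha x lambda theta (extend g) i.+1.
Proof.
move=> N0 alpha1 iN.
pose st0 := load (input Ne alpha x lambda theta g).
have d0 : holds_data N Ne alpha x lambda theta st0 by exact: load_data.
pose copy := store_expr (at_offset 6 1) (Read (at_offset 4 0)).
pose st1 := exec N Ne (For (ISub IN (INum 1)) copy) [::] st0.
have d1 : holds_data N Ne alpha x lambda theta st1 by exact: holds_data_exec.
have v1 : holds_nodal_values N (extend g) st1.
  have inj n : {in gtn n &, injective (fun k => k + 1)%N} by move=> ? ? _ _ /addIn.
  have [H6 H6'] := @exec_fill R N Ne [::] (ISub IN (INum 1)) (at_offset 6 1)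
    (Read (at_offset 4 0)) st0 isT isT isT (inj _).
  have out j : (forall k, (k < N - 1)%N -> (k + 1)%N != j) ->
      memory st1 (6, j)%N = 0.
    by move=> jN; apply: etrans (H6' j jN) _; exact: load_zero.
  case=> [_|k kN]; first by apply: out => k _; rewrite addn1.
  have [kN'|Nk] := ltnP k (N - 1).
    rewrite -[X in (6, X)%N]addn1; apply: etrans (H6 k kN') _.
    rewrite -[eval _ _ _ _ _]/(memory st0 (4, k + 0)%N) addn0.
    exact: load_vector.
  rewrite out => [|j jN]; last by apply/eqP; lia.
  have -> : k.+1 = N by lia.
  by rewrite extend_last.
pose st2 := exec N Ne (store_expr C_reg Calpha_expr) [::] st1.
have d2 : holds_data N Ne alpha x lambda theta st2 by exact: holds_data_exec.
have v2 : holds_nodal_values N (extend g) st2.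
  by move=> k kN; rewrite /st2 exec_frame //; exact: v1.
pose st3 := exec N Ne weights_prog [::] st2.
have d3 : holds_data N Ne alpha x lambda theta st3 by exact: holds_data_exec.
have v3 : holds_nodal_values N (extend g) st3.
  by move=> k kN; rewrite /st3 exec_frame //; exact: v2.
have acc3 k : memory st3 (9, k)%N = 0.
  by rewrite /st3 exec_frame // /st2 exec_frame // /st1 exec_frame // load_zero.
pose st4 := exec N Ne nonlocal_prog [::] st3.
have d4 : holds_data N Ne alpha x lambda theta st4 by exact: holds_data_exec.
have v4 : holds_nodal_values N (extend g) st4.
  by move=> k kN; rewrite /st4 exec_frame //; exact: v3.
have C4 : memory st4 (11, 0)%N = Calpha alpha.
  rewrite /st4 exec_frame; last by [].
  rewrite /st3 exec_frame; last by [].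
  exact: exec_Calpha d1.
have w4 k : (k < N)%N ->
    memory st4 (10, k.+1)%N = local_weight alpha (step x k.+1).
  by move=> kN; rewrite /st4 exec_frame // /st3 (exec_weights alpha1 d2).
have a4 k : (0 < k < N)%N -> memory st4 (9, k)%N = _ :=
  exec_nonlocal d3 v3 acc3.
rewrite -[run _ _ _ _]/(exec N Ne (For (ISub IN (INum 1))
  (store_expr (at_offset 5 0) output_expr)) [::] st4).
clearbody st4.
have inj n : {in gtn n &, injective (fun k => k + 0)%N} by move=> ? ? _ _ /addIn.
have [H5 _] := @exec_fill R N Ne [::] (ISub IN (INum 1)) (at_offset 5 0)
  output_expr st4 isT isT isT (inj _).
rewrite -[X in (5, X)%N]addn0.
apply: etrans (H5 i _) _; first by rewrite /=; lia.
rewrite /= /address_sem /= addn0 addn1 addn2 C4 !w4 ?v4 ?a4; try lia.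
case: d4 => -> _ _ _.
by rewrite /node_value sub0r.
Qed.

End MatVec.

Theorem theorem2p6 (R : realType) :
  exists (p : program) (K : nat),
    forall (N Ne : nat) (alpha : R) (x lambda theta : nat -> R)
      (g : 'cV[R]_N.-1),
      (0 < N)%N -> (0 < Ne)%N ->
      1 <= alpha < 2 ->
      (forall j : nat, (j < N)%N -> x j < x j.+1) ->
      (forall s : nat, (s < Ne)%N -> 0 < lambda s) ->
      (forall s : nat, (s < Ne)%N -> 0 < theta s) ->
      let st := run N Ne p (input Ne alpha x lambda theta g) in
      [/\ output N.-1 st = coef_mx N Ne alpha x lambda theta *m g,
          (ops st <= K * (N * Ne))%N
        & (memory_usage st <= K * (N * Ne))%N].
Proof.
(* 605 = 3 * 200 + 5: three cells for each operation, and an input of size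
   2 N + 2 Ne + 1 <= 5 N Ne. *)
exists matvec_prog, 605%N => N Ne alpha x lambda theta g N0 Ne0 /andP[alpha1 _].
move=> x_incr lambda_gt0 _ st; have cost_le := cost_matvec_prog N0 Ne0; split.
- apply/matrixP => i j; rewrite (ord1 j) mxE mulmx_coef_mx //.
  exact: run_matvec_prog (ltn_ord i).
- apply: leq_trans (ops_exec _ _ _ _ _) _; rewrite add0n.
  by apply: leq_trans cost_le _; rewrite leq_mul2r orbT.
- apply: leq_trans (memory_usage_exec _ _ _ _ _) _ => //.
  have -> : size (touched (load (input Ne alpha x lambda theta g)))
      = (2 * N + 2 * Ne + 1)%N.
    by apply: etrans (size_map _ _) _; exact: size_input.
  have : (2 * N + 2 * Ne + 1 <= 5 * (N * Ne))%N by nia.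
  by lia.
Qed.
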